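(* Let $a,b,c>0$ with $a>b$, and let $M_0$ be the ellipsoid $\frac{x^2}{a}+\frac{y^2}{b}+\frac{z^2}{c}=1$ in $\mathbb{R}^3$ with the metric induced from the Minkowski metric $dx^2+dy^2-dz^2$. For a tangent vector $(u,v,w)$ to $M_0$ at the point $(x,y,z)\in M_0$ put $$J=\left(\frac{x^2}{a^2}+\frac{y^2}{b^2}-\frac{z^2}{c^2}\right)\left(\frac{u^2}{a}+\frac{v^2}{b}+\frac{w^2}{c}\right).$$ Then $J$ is an integral of the geodesic flow on $M_0$: for every parameterized geodesic $\gamma(t)=(x(t),y(t),z(t))$ of the induced metric, the value of $J$ at $(\gamma(t),\dot\gamma(t))$ does not depend on $t$.
   Context: Write $\langle\cdot,\cdot\rangle$ for the Minkowski metric $dx^2+dy^2-dz^2$. The induced metric on $M_0$ is degenerate exactly along the two curves $z=\pm c\sqrt{\frac{x^2}{a^2}+\frac{y^2}{b^2}}$ on $M_0$ (the tropics). Parameterized geodesics are considered off the tropics; they are the curves $\gamma(t)$ on $M_0$ that are extrema of $\int\langle\dot\gamma,\dot\gamma\rangle\,dt$, i.e. that satisfy $\ddot\gamma(t)=\lambda(t)N(\gamma(t))$ for some scalar function $\lambda(t)$, where $N(x,y,z)=\left(\frac{x}{a},\frac{y}{b},-\frac{z}{c}\right)$ is a Minkowski normal to $M_0$. *)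

(* Defs.v *)
From Stdlib Require Import Reals Lra.
From Coquelicot Require Import Coquelicot.
Open Scope R_scope.

(* A normed module (hence carrying vector-valued [is_derive]) through
   Coquelicot's product instances; [(x, y, z)] is [((x, y), z)]. *)
Definition R3 : Type := (R * R * R)%type.

Definition mink (p q : R3) : R :=
  let '(x1, y1, z1) := p in
  let '(x2, y2, z2) := q in
  x1 * x2 + y1 * y2 - z1 * z2.

(* The semi-axes are the square roots of a, b, c. *)
Definition M0 (a b c : R) (p : R3) : Prop :=
  let '(x, y, z) := p in x ^ 2 / a + y ^ 2 / b + z ^ 2 / c = 1.

Definition tangent (a b c : R) (p v : R3) : Prop :=
  let '(x, y, z) := p in
  let '(u, v, w) := v in x * u / a + y * v / b + z * w / c = 0.

Definition tropic (a b c : R) (p : R3) : Prop :=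
  let '(x, y, z) := p in
  z = c * sqrt (x ^ 2 / a ^ 2 + y ^ 2 / b ^ 2) \/
  z = - (c * sqrt (x ^ 2 / a ^ 2 + y ^ 2 / b ^ 2)).

Definition normal (a b c : R) (p : R3) : R3 :=
  let '(x, y, z) := p in (x / a, y / b, - (z / c)).

Lemma normal_orthogonal (a b c : R) (p v : R3) :
  tangent a b c p v <-> mink (normal a b c p) v = 0.
Proof.
  destruct p as [[x y] z], v as [[u v] w]; unfold tangent, mink, normal.
  unfold Rdiv; split; intros H; rewrite <- H; ring.
Qed.

(* Meaningful where [gamma] is differentiable, as [geodesic] demands. *)
Definition velocity (gamma : R -> R3) (t : R) : R3 :=
  (Derive (fun s => fst (fst (gamma s))) t,
   Derive (fun s => snd (fst (gamma s))) t,
   Derive (fun s => snd (gamma s)) t).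

Definition in_open_interval (alpha beta : Rbar) (t : R) : Prop :=
  Rbar_lt alpha t /\ Rbar_lt t beta.

(* Parameterized geodesic of M0 off the tropics, on the (possibly unbounded)
   open interval (alpha, beta): the acceleration is lambda(t) N(gamma(t)). *)
Definition geodesic (a b c : R) (alpha beta : Rbar) (gamma : R -> R3) : Prop :=
  exists lambda : R -> R,
    forall t : R, in_open_interval alpha beta t ->
      M0 a b c (gamma t) /\
      ~ tropic a b c (gamma t) /\
      is_derive gamma t (velocity gamma t) /\
      is_derive (velocity gamma) t (scal (lambda t) (normal a b c (gamma t))).

Definition J (a b c : R) (p v : R3) : R :=
  let '(x, y, z) := p in
  let '(u, v, w) := v in
  (x ^ 2 / a ^ 2 + y ^ 2 / b ^ 2 - z ^ 2 / c ^ 2) *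
  (u ^ 2 / a + v ^ 2 / b + w ^ 2 / c).

(* Main.v *)
Require Import Defs.
From Stdlib Require Import Reals Lra.
From Coquelicot Require Import Coquelicot.
Open Scope R_scope.

(** Write [F = x^2/a^2 + y^2/b^2 - z^2/c^2] and [G = u^2/a + v^2/b + w^2/c], so
    that [J = F G], and put [P = x u/a^2 + y v/b^2 - z w/c^2]. Along a geodesic
    [F' = 2 P] and [G' = 2 lambda P], while differentiating the equation of the
    ellipsoid twice gives [G + lambda F = 0]. Hence
    [J' = 2 P (G + lambda F) = 0]. *)

(** A projection is linear, hence its own differential, and it commutes with scaling by definition;
    the chain rule does the rest. *)
Lemma is_derive_fst {U V : NormedModule R_AbsRing} (f : R -> U * V) (t : R)
  (l : U * V) :
  is_derive f t l -> is_derive (fun s => fst (f s)) t (fst l).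
Proof.
  intros H.
  apply (filterdiff_comp' f fst t _ fst H).
  apply filterdiff_linear, is_linear_fst.
Qed.

Lemma is_derive_snd {U V : NormedModule R_AbsRing} (f : R -> U * V) (t : R)
  (l : U * V) :
  is_derive f t l -> is_derive (fun s => snd (f s)) t (snd l).
Proof.
  intros H.
  apply (filterdiff_comp' f snd t _ snd H).
  apply filterdiff_linear, is_linear_snd.
Qed.

Lemma is_derive_R3 (f : R -> R3) (t x y z : R) :
  is_derive f t ((x, y, z) : R3) ->
  is_derive (fun s => fst (fst (f s))) t x /\
  is_derive (fun s => snd (fst (f s))) t y /\
  is_derive (fun s => snd (f s)) t z.
Proof.
  intros H; split; [ | split].
  - exact (is_derive_fst _ _ _ (is_derive_fst _ _ _ H)).
  - exact (is_derive_snd _ _ _ (is_derive_fst _ _ _ H)).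
  - exact (is_derive_snd _ _ _ H).
Qed.

Lemma locally_in_open_interval (alpha beta : Rbar) (t : R) :
  in_open_interval alpha beta t -> locally t (in_open_interval alpha beta).
Proof.
  apply (open_and (fun s : R => Rbar_lt alpha s) (fun s : R => Rbar_lt s beta)).
  - apply open_Rbar_gt.
  - apply open_Rbar_lt.
Qed.

Lemma in_open_interval_between (alpha beta : Rbar) (s t r : R) :
  in_open_interval alpha beta s -> in_open_interval alpha beta t ->
  s <= r <= t -> in_open_interval alpha beta r.
Proof.
  intros [Hs _] [_ Ht] [Hsr Hrt]; split.
  - now apply Rbar_lt_le_trans with (Finite s).
  - now apply Rbar_le_lt_trans with (Finite t).
Qed.

(** Serves to differentiate identities known only along the geodesic: the interval is open, so they
    hold on a neighbourhood of each of its times. *)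
Lemma is_derive_locally_const (f : R -> R) (t k l : R) :
  locally t (fun s => f s = k) -> is_derive f t l -> l = 0.
Proof.
  intros Hk Hf.
  rewrite <- (is_derive_unique _ _ _ Hf), (Derive_ext_loc _ _ _ Hk).
  apply Derive_const.
Qed.

(** The interval is convex, so the derivative vanishes on the whole segment joining the two times;
    [eq_is_derive] wants its endpoints ordered. *)
Lemma is_derive_0_const (alpha beta : Rbar) (f : R -> R) :
  (forall t, in_open_interval alpha beta t -> is_derive f t 0) ->
  forall s t, in_open_interval alpha beta s -> in_open_interval alpha beta t ->
  f s = f t.
Proof.
  intros Hf s t Hs Ht.
  destruct (Rtotal_order s t) as [Hst | [-> | Hst]].
  - apply eq_is_derive; [intros r Hr | exact Hst].
    apply Hf; exact (in_open_interval_between _ _ _ _ _ Hs Ht Hr).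
  - reflexivity.
  - symmetry; apply eq_is_derive; [intros r Hr | exact Hst].
    apply Hf; exact (in_open_interval_between _ _ _ _ _ Ht Hs Hr).
Qed.

(** Common shape of every term below: squares arise as [f * f], and the tangency condition as
    position times velocity. *)
Lemma is_derive_mult_div (f g : R -> R) (t f' g' k : R) :
  is_derive f t f' -> is_derive g t g' ->
  is_derive (fun s => f s * g s / k) t ((f' * g t + f t * g') / k).
Proof.
  intros Hf Hg.
  apply (is_derive_ext (fun s => / k * (f s * g s))).
  { intros s; unfold Rdiv; apply Rmult_comm. }
  unfold Rdiv; rewrite Rmult_comm.
  apply is_derive_scal; exact (is_derive_mult _ _ _ _ _ Hf Hg Rmult_comm).
Qed.

Lemma is_derive_sum3 (f g h : R -> R) (t f' g' h' : R) :
  is_derive f t f' -> is_derive g t g' -> is_derive h t h' ->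
  is_derive (fun s => f s + g s + h s) t (f' + g' + h').
Proof.
  intros Hf Hg Hh.
  exact (is_derive_plus _ _ _ _ _ (is_derive_plus _ _ _ _ _ Hf Hg) Hh).
Qed.

Theorem proposition2p1 (a b c : R) (Ha : 0 < a) (Hb : 0 < b) (Hc : 0 < c)
  (Hab : b < a) (alpha beta : Rbar) (gamma : R -> R3)
  (Hgamma : geodesic a b c alpha beta gamma) :
  forall s t : R,
    in_open_interval alpha beta s -> in_open_interval alpha beta t ->
    J a b c (gamma s) (velocity gamma s) = J a b c (gamma t) (velocity gamma t).
Proof.
  destruct Hgamma as [lambda Hgeo].
  set (x := fun s => fst (fst (gamma s))).
  set (y := fun s => snd (fst (gamma s))).
  set (z := fun s => snd (gamma s)).
  set (u := Derive x); set (v := Derive y); set (w := Derive z).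
  assert (Egamma : forall s, gamma s = (x s, y s, z s)).
  { intros s; unfold x, y, z; now destruct (gamma s) as [[? ?] ?]. }
  assert (Hpos : forall s, in_open_interval alpha beta s ->
    is_derive x s (u s) /\ is_derive y s (v s) /\ is_derive z s (w s)).
  { intros s Hs; destruct (Hgeo s Hs) as (_ & _ & H & _).
    exact (is_derive_R3 _ _ _ _ _ H). }
  assert (Hvel : forall s, in_open_interval alpha beta s ->
    is_derive u s (lambda s * (x s / a)) /\
    is_derive v s (lambda s * (y s / b)) /\
    is_derive w s (lambda s * - (z s / c))).
  (* By conversion, the coordinates of [velocity gamma] are [u], [v], [w], and [scal] acts
     coordinatewise. *)
  { intros s Hs; destruct (Hgeo s Hs) as (_ & _ & _ & H).
    rewrite Egamma in H; exact (is_derive_R3 _ _ _ _ _ H). }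
  assert (Htan : forall s, in_open_interval alpha beta s ->
    x s * u s / a + y s * v s / b + z s * w s / c = 0).
  { intros s Hs; destruct (Hpos s Hs) as (Dx & Dy & Dz).
    pose proof (is_derive_sum3 _ _ _ _ _ _ _
      (is_derive_mult_div _ _ _ _ _ a Dx Dx)
      (is_derive_mult_div _ _ _ _ _ b Dy Dy)
      (is_derive_mult_div _ _ _ _ _ c Dz Dz)) as D.
    apply (is_derive_locally_const _ _ 1) in D.
    (* The derivative of the ellipsoid equation is twice the tangency expression. *)
    - apply (Rmult_eq_reg_l 2); [rewrite Rmult_0_r, <- D; field | ]; lra.
    - generalize (locally_in_open_interval _ _ _ Hs); apply filter_imp.
      intros r Hr; destruct (Hgeo r Hr) as (H & _).
      rewrite Egamma in H; rewrite <- H; field; lra. }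
  (* Differentiating tangency, the squared velocities give [G], and the accelerations give
     [lambda F], whose minus sign comes from the last coordinate of the normal. *)
  assert (Hlambda : forall s, in_open_interval alpha beta s ->
    (u s ^ 2 / a + v s ^ 2 / b + w s ^ 2 / c) +
    lambda s * (x s ^ 2 / a ^ 2 + y s ^ 2 / b ^ 2 - z s ^ 2 / c ^ 2) = 0).
  { intros s Hs; destruct (Hpos s Hs) as (Dx & Dy & Dz).
    destruct (Hvel s Hs) as (Du & Dv & Dw).
    pose proof (is_derive_sum3 _ _ _ _ _ _ _
      (is_derive_mult_div _ _ _ _ _ a Dx Du)
      (is_derive_mult_div _ _ _ _ _ b Dy Dv)
      (is_derive_mult_div _ _ _ _ _ c Dz Dw)) as D.
    apply (is_derive_locally_const _ _ 0) in D.
    - rewrite <- D; field; lra.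
    - generalize (locally_in_open_interval _ _ _ Hs); apply filter_imp.
      exact Htan. }
  apply (is_derive_0_const alpha beta
    (fun s => J a b c (gamma s) (velocity gamma s))).
  intros s Hs; destruct (Hpos s Hs) as (Dx & Dy & Dz).
  destruct (Hvel s Hs) as (Du & Dv & Dw).
  pose proof (is_derive_mult _ _ _ _ _
    (is_derive_sum3 _ _ _ _ _ _ _
      (is_derive_mult_div _ _ _ _ _ (a ^ 2) Dx Dx)
      (is_derive_mult_div _ _ _ _ _ (b ^ 2) Dy Dy)
      (* The divisor [- c ^ 2], that is [-(c ^ 2)], supplies the minus sign in [F]. *)
      (is_derive_mult_div _ _ _ _ _ (- c ^ 2) Dz Dz))
    (is_derive_sum3 _ _ _ _ _ _ _
      (is_derive_mult_div _ _ _ _ _ a Du Du)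
      (is_derive_mult_div _ _ _ _ _ b Dv Dv)
      (is_derive_mult_div _ _ _ _ _ c Dw Dw)) Rmult_comm) as D.
  unfold plus, mult in D; simpl in D.
  match type of D with is_derive _ _ ?l => replace l with 0 in D end.
  - revert D; apply is_derive_ext; intros r.
    rewrite Egamma.
    (* The middle term exposes the coordinates to [field]; [velocity gamma r] is convertible to
       [(u r, v r, w r)]. *)
    apply (eq_trans (A := R) (y := J a b c (x r, y r, z r) (u r, v r, w r)));
      [unfold J; field; lra | reflexivity].
  (* Here 0 is expanded into [2 P (G + lambda F)], which equals the product-rule derivative
     [F' G + F G']. *)
  - rewrite <- (Rmult_0_r (2 *
      (x s * u s / a ^ 2 + y s * v s / b ^ 2 - z s * w s / c ^ 2))).
    rewrite <- (Hlambda s Hs); field; lra.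
Qed.
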